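(* Let $A$ be a finite non-empty alphabet, let $\lambda$ be a left-infinite word over $A$ and $\rho$ a right-infinite word over $A$. The set $ROG_{\lambda,\rho}=\{rog(\lambda_n,\rho_n): n\in\mathbb{N}\}$ is finite if and only if $\lambda={}^{\omega}u\,w_1$ and $\rho=w_2\,u^{\omega}$ for some words $u\in A^+$ and $w_1,w_2\in A^*$.
   Context: $A^*$ is the free monoid (finite words, including the empty word) and $A^+$ the set of non-empty finite words over $A$; $\mathbb{N}=\{0,1,2,\dots\}$. A left-infinite word is a sequence $\cdots a_{-2}a_{-1}a_0$ of letters indexed by $-\mathbb{N}$; a right-infinite word is a sequence $a_0a_1a_2\cdots$ indexed by $\mathbb{N}$. For $u\in A^+$ and $w\in A^*$, ${}^{\omega}u\,w$ denotes the left-infinite word $\cdots uuuw$ and $w\,u^{\omega}$ the right-infinite word $wuuu\cdots$. For $n\in\mathbb{N}$, $\lambda_n$ is the suffix of length $n$ of $\lambda$ and $\rho_n$ the prefix of length $n$ of $\rho$. For finite words $u,v$ of equal length, $rog(u,v)=\min\{n\in\mathbb{N}: xu=vx' \text{ for some } x,x'\in A^n\}$. *)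

(* Defs.v *)
From HB Require Import structures.
From mathcomp Require Import all_boot all_algebra.
From mathcomp Require Import all_classical.

Set Implicit Arguments.
Unset Strict Implicit.
Unset Printing Implicit Defensive.

(* [l i] is the letter a_{-i} of the left-infinite word ... a_{-2} a_{-1} a_0. *)
Definition left_word (A : Type) := nat -> A.

Definition right_word (A : Type) := nat -> A.

(* The suffix a_{-(n-1)} ... a_{-1} a_0. *)
Definition left_suffix (A : Type) (l : left_word A) (n : nat) : n.-tuple A :=
  [tuple l (rev_ord i) | i < n].

Definition right_prefix (A : Type) (r : right_word A) (n : nat) : n.-tuple A :=
  [tuple r i | i < n].

(* Elements of A^+ are tuples of length k.+1.  In the next two definitions the
   default value of [nth] is the letter read once [w] is exhausted. *)
Definition right_omega (A : Type) (k : nat) (w : seq A) (u : k.+1.-tuple A) :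
    right_word A :=
  fun i => nth (tnth u (inZp (i - size w))) w i.

Definition left_omega (A : Type) (k : nat) (u : k.+1.-tuple A) (w : seq A) :
    left_word A :=
  fun i => nth (tnth u (rev_ord (inZp (i - size w)))) (rev w) i.

Definition overlap (A : finType) (k : nat) (u v : k.-tuple A) : pred nat :=
  fun n => [exists x : n.-tuple A, exists x' : n.-tuple A,
              (x ++ u == v ++ x' :> seq A)].

Lemma overlap_ex (A : finType) (k : nat) (u v : k.-tuple A) :
  exists n, overlap u v n.
Proof. by exists k; apply/existsP; exists v; apply/existsP; exists u. Qed.

Definition rog (A : finType) (k : nat) (u v : k.-tuple A) : nat :=
  ex_minn (overlap_ex u v).

Definition ROG (A : finType) (l : left_word A) (r : right_word A) : set nat :=
  range (fun n => rog (left_suffix l n) (right_prefix r n)).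

(* Main.v *)
Require Import Defs.
From HB Require Import structures.
From mathcomp Require Import all_boot all_algebra.
From mathcomp Require Import all_classical.
From mathcomp Require Import zify.

(** Reading letters, [xu = vx'] with [|x| = n] says that [rho_i = lambda_j]
    whenever [i, j >= n] and [i + j + 1 = k + n], where [k] is the length of
    [u] and [v].  If all values of [rog] are at most [N], the tails [R], [L] of
    [rho], [lambda] past [N] satisfy [R i = L j] on the antidiagonals
    [i + j = s] for a syndetic set of [s].  Comparing two nearby antidiagonals
    shows that arbitrarily long prefixes of [R] and [L] have a period at most
    [2N + 1], so both tails have period [(2N + 1)!].  Conversely, if both words
    are ultimately periodic with the same [u], every [p] consecutive
    antidiagonals, [p = |u|], contain one on which the tails agree. *)

Lemma nth_left_suffix (A : Type) (a : A) (l : left_word A) n i :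
  i < n -> nth a (left_suffix l n) i = l (n - i.+1).
Proof.
move=> lt_in; have -> : i = Ordinal lt_in :> nat by [].
by rewrite -tnth_nth tnth_mktuple.
Qed.

Lemma nth_right_prefix (A : Type) (a : A) (r : right_word A) n i :
  i < n -> nth a (right_prefix r n) i = r i.
Proof.
move=> lt_in; have {1}-> : i = Ordinal lt_in :> nat by [].
by rewrite -tnth_nth tnth_mktuple.
Qed.

Lemma overlap_nth (A : finType) (l : left_word A) (r : right_word A) k n :
  overlap (left_suffix l k) (right_prefix r k) n ->
  forall i j, n <= i -> n <= j -> (i + j).+1 = k + n -> r i = l j.
Proof.
move=> /existsP[x /existsP[x' /eqP eq_xx']] i j le_ni le_nj eq_ij.
(* The bound [n <= j] serves to keep position [i] inside [v]; [n <= i] puts it past [x]. *)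
have lt_ik : i < k by lia.
have := congr1 (fun s => nth (r 0) s i) eq_xx'.
rewrite !nth_cat !size_tuple lt_ik ltnNge le_ni /= nth_right_prefix //.
by rewrite nth_left_suffix; [move=> <-; congr l|]; lia.
Qed.

(** When [n <= k] the witnesses are forced: [x] is the prefix of [v] and [x'] the suffix of [u] of
    length [n]. *)
Lemma nth_overlap (A : finType) (l : left_word A) (r : right_word A) k n :
  n <= k ->
  (forall i j, n <= i -> n <= j -> (i + j).+1 = k + n -> r i = l j) ->
  overlap (left_suffix l k) (right_prefix r k) n.
Proof.
move=> le_nk eq_rl; apply/existsP; exists (right_prefix r n).
apply/existsP; exists (left_suffix l n); apply/eqP.
apply: (@eq_from_nth _ (r 0)) => [|i].
  by rewrite !size_cat !size_tuple addnC.
rewrite size_cat !size_tuple !nth_cat !size_tuple => lt_i.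
case: (ltnP i n) => le_in.
  by rewrite (leq_trans le_in le_nk) !nth_right_prefix ?(leq_trans le_in).
rewrite nth_left_suffix; last by lia.
case: (ltnP i k) => le_ik.
  by rewrite nth_right_prefix //; apply/esym/eq_rl; lia.
by rewrite nth_left_suffix; [congr l|]; lia.
Qed.

Lemma rog_overlap (A : finType) k (u v : k.-tuple A) : overlap u v (rog u v).
Proof. by rewrite /rog; case: ex_minnP. Qed.

Lemma rog_le (A : finType) k (u v : k.-tuple A) n :
  overlap u v n -> rog u v <= n.
Proof. by rewrite /rog; case: ex_minnP => m _; apply. Qed.

Lemma rog_le_length (A : finType) k (u v : k.-tuple A) : rog u v <= k.
Proof.
by apply: rog_le; apply/existsP; exists v; apply/existsP; exists u.
Qed.

Lemma finite_rangeP (f : nat -> nat) :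
  finite_set (range f) <-> exists N, forall n, f n <= N.
Proof.
split=> [/finite_seqP[s eq_s]|[N le_fN]].
  exists (\max_(i <- s) i) => n; apply: leq_bigmax_seq => //.
  by have : range f (f n) by []; rewrite eq_s.
apply: sub_finite_set (finite_II N.+1) => _ [n _ <-] /=.
by rewrite ltnS.
Qed.

Lemma left_omega_tail (A : Type) k (u : k.+1.-tuple A) (w : seq A) m :
  left_omega u w (size w + m) = tnth u (rev_ord (inZp m)).
Proof.
by rewrite /left_omega nth_default ?size_rev ?leq_addr // addKn.
Qed.

Lemma right_omega_tail (A : Type) k (u : k.+1.-tuple A) (w : seq A) m :
  right_omega w u (size w + m) = tnth u (inZp m).
Proof. by rewrite /right_omega nth_default ?leq_addr // addKn. Qed.

(** Modulo [k.+1], [rev_ord] is the map sending [y] to [-1 - y]. *)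
Lemma inZp_rev k a b q :
  (a + b).+1 = q * k.+1 -> inZp a = rev_ord (inZp b) :> 'I_k.+1.
Proof.
move=> eq_ab; apply: val_inj => /=.
have := divn_eq a k.+1; have := divn_eq b k.+1.
have := ltn_pmod a (ltn0Sn k); have := ltn_pmod b (ltn0Sn k).
move: (a %% _) (b %% _) (a %/ _) (b %/ _) => x y c d lt_y lt_x eq_b eq_a.
have [t eq_t] : exists t, (x + y).+1 = t * k.+1.
  by exists (q - (c + d)); rewrite mulnBl mulnDl -eq_ab; lia.
(* Two remainders plus one lie strictly between 0 and [2 * k.+1]. *)
have t1 : t = 1 by nia.
by rewrite subSS; lia.
Qed.

Lemma omega_rog_bounded (A : finType) k (u : k.+1.-tuple A) (w1 w2 : seq A) n :
  rog (left_suffix (left_omega u w1) n) (right_prefix (right_omega w2 u) n)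
    <= size w1 + size w2 + k.+1.
Proof.
pose c := size w1 + size w2.
(* This makes [n + m - c] a multiple of [k.+1], so that the two periodic tails are in phase. *)
pose m := c + (k.+1 - n %% k.+1).
have lt_mod := ltn_pmod n (ltn0Sn k).
have le_m : m <= c + k.+1 by rewrite leq_add2l leq_subr.
apply: leq_trans le_m; case: (leqP m n) => [le_mn|lt_nm]; last first.
  by apply: leq_trans (rog_le_length _ _ _ _) (ltnW lt_nm).
apply/rog_le/nth_overlap => // i j le_mi le_mj eq_ij.
have le_cm : c <= m by apply: leq_addr.
have -> : i = size w2 + (i - size w2) by lia.
have -> : j = size w1 + (j - size w1) by lia.
rewrite left_omega_tail right_omega_tail.
congr tnth; apply: (inZp_rev _ _ _ (n %/ k.+1).+1).
have := divn_eq n k.+1; rewrite mulSn; lia.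
Qed.

Lemma periodM (A : Type) (f : nat -> A) d K m i :
  (forall j, j <= K -> f (j + d) = f j) -> i + m * d <= K ->
  f (i + m * d) = f i.
Proof.
move=> per; elim: m => [|m IHm] le_K; first by rewrite addn0.
by rewrite mulSnr addnA per; [apply: IHm|]; lia.
Qed.

(** The period [d] may change with [K], but every candidate divides [M]!. *)
Lemma bounded_period_fact (A : Type) (f : nat -> A) M :
  (forall K, exists d, 0 < d <= M /\ forall j, j <= K -> f (j + d) = f j) ->
  forall i, f (i + M`!) = f i.
Proof.
move=> per i; have [d [d_bounds perd]] := per (i + M`!).
have /dvdnP[q eq_q] : d %| M`! by apply: dvdn_fact.
by rewrite eq_q; apply: periodM perd _; rewrite eq_q.
Qed.

Lemma period_modn (A : Type) (f : nat -> A) p :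
  (forall i, f (i + p) = f i) -> forall i m, f (i + m) = f (i + m %% p).
Proof.
move=> per i m; rewrite {1}(divn_eq m p) addnC -addnA [_ %% _ + _]addnC addnC.
by apply: (@periodM _ _ _ (i + m %% p + m %/ p * p)).
Qed.

(** As [L] is indexed away from its right end, this says that its suffix of length [s.+1] is the
    prefix of [R] of that length. *)
Definition antidiagonal_agree (A : Type) (L R : nat -> A) s :=
  forall i j, i + j = s -> R i = L j.

Lemma agree_tails_period (A : Type) (L R : nat -> A) N K :
  (forall k, exists s, k <= s <= k + N /\ antidiagonal_agree A L R s) ->
  exists d, 0 < d <= N.*2.+1 /\
    forall j, j <= K -> R (j + d) = R j /\ L (j + d) = L j.
Proof.
move=> syndetic; have [s [s_bounds agree_s]] := syndetic K.
(* Starting past [K + N] forces [s < t], and [t - s] is at most [N.*2.+1]. Both [R j] and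
   [R (j + (t - s))] equal [L (s - j)], and symmetrically for [L]. *)
have [t [t_bounds agree_t]] := syndetic (K + N).+1.
exists (t - s); split=> [|j le_j]; first by lia.
split.
  by rewrite (agree_s j (s - j)) ?(agree_t _ (s - j)) //; lia.
by rewrite -(agree_s (s - j) j) -?(agree_t (s - j)) //; lia.
Qed.

Lemma agree_tails_common_period (A : Type) (L R : nat -> A) N :
  (forall k, exists s, k <= s <= k + N /\ antidiagonal_agree A L R s) ->
  exists p, 0 < p /\
    (forall i, R (i + p) = R i) /\ (forall i, L (i + p) = L i).
Proof.
move=> syndetic; exists (N.*2.+1)`!; split; first exact: fact_gt0.
by split; apply: bounded_period_fact => K;
  have [d [d_bounds per]] := agree_tails_period A L R N K syndetic;
  exists d; split=> // j /per[].
Qed.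

Lemma right_omegaE (A : Type) (r : right_word A) n k :
  (forall i, r (n + i + k.+1) = r (n + i)) ->
  r = right_omega (right_prefix r n) [tuple r (n + i) | i < k.+1].
Proof.
move=> per; apply/funext => i; case: (ltnP i n) => [lt_in|le_ni].
  by rewrite /right_omega nth_right_prefix.
rewrite -(subnKC le_ni); move: (i - n) => m.
have := right_omega_tail _ _ [tuple r (n + i) | i < k.+1] (right_prefix r n) m.
rewrite size_tuple tnth_mktuple => ->.
apply: (period_modn _ (fun i => r (n + i)) k.+1 _ 0) => j.
by rewrite addnA.
Qed.

Lemma left_omegaE (A : Type) (l : left_word A) n k (u : k.+1.-tuple A) :
  (forall m, l (n + m) = tnth u (rev_ord (inZp m))) ->
  l = left_omega u (left_suffix l n).
Proof.
move=> tail; apply/funext => i; case: (ltnP i n) => [lt_in|le_ni].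
  rewrite /left_omega nth_rev size_tuple // nth_left_suffix; last by lia.
  by congr l; lia.
rewrite -(subnKC le_ni) tail.
by have := left_omega_tail _ _ u (left_suffix l n) (i - n); rewrite size_tuple.
Qed.

Lemma rog_bounded_omega (A : finType) (l : left_word A) (r : right_word A) N :
  (forall n, rog (left_suffix l n) (right_prefix r n) <= N) ->
  exists (k : nat) (u : k.+1.-tuple A) (w1 w2 : seq A),
    l = left_omega u w1 /\ r = right_omega w2 u.
Proof.
move=> le_rog; pose L j := l (N + j); pose R i := r (N + i).
have synd k : exists s, k <= s <= k + N /\ antidiagonal_agree A L R s.
  (* Dropping [N] letters from each word lowers the index sum by [N.*2], which turns this length
     into the antidiagonal [k + n]. *)
  pose n := rog (left_suffix l (k + N.*2.+1)) (right_prefix r (k + N.*2.+1)).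
  have le_nN : n <= N by apply: le_rog.
  have ov_n : overlap _ _ n := rog_overlap _ _ _ _.
  move: n le_nN ov_n => n le_nN ov_n.
  exists (k + n); split=> [|i j eq_ij]; first by lia.
  by apply: (overlap_nth _ _ _ _ _ ov_n); lia.
have [p [p_gt0 [perR perL]]] := agree_tails_common_period _ _ _ _ synd.
case: p p_gt0 perR perL => // k _ perR perL.
have [s [/andP[le_ks _] agree_s]] := synd k.
exists k, [tuple r (N + i) | i < k.+1].
(* The word [u] is read off [R]; cutting [l] a further [s.+1] letters in gives it the right phase,
   because [R (k - m)] is [L (s - (k - m))], one period before [L (s.+1 + m)]. *)
exists (left_suffix l (N + s.+1)), (right_prefix r N); split; last first.
  by apply: right_omegaE => i; rewrite -addnA; apply: perR.
apply: left_omegaE => m; rewrite tnth_mktuple -addnA -/(L _) -/(R _) /= subSS.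
have := ltn_pmod m (ltn0Sn k).
rewrite (period_modn _ _ _ perL); move: (m %% _) => {}m lt_m.
rewrite (agree_s _ (s - (k - m))); last by lia.
by rewrite -[RHS]perL; congr L; lia.
Qed.

Theorem theorem3p5 (A : finType) (hA : 0 < #|A|)
    (l : left_word A) (r : right_word A) :
  finite_set (ROG l r) <->
  exists (k : nat) (u : k.+1.-tuple A) (w1 w2 : seq A),
    l = left_omega u w1 /\ r = right_omega w2 u.
Proof.
split=> [/finite_rangeP[N]|[k [u [w1 [w2 [-> ->]]]]]].
  exact: rog_bounded_omega.
apply/finite_rangeP; exists (size w1 + size w2 + k.+1) => n.
exact: omega_rog_bounded.
Qed.
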